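(* Let $n\ge 3$. The number of isomorphism classes of semirigid $3$-nilpotent semigroups of cardinality $n$ is at most $$Q_n=\sum_{r=1}^{n-2}\ \sum_{\lambda\vdash r}\frac{\left\{ {\beta(\lambda)+1 \atop n-r} \right\}}{w(\lambda)},$$ and $Q_n$ is at most the number of isomorphism classes of all $3$-nilpotent semigroups of cardinality $n$.
   Context: A semigroup $S$ is $3$-nilpotent if it is finite, has a zero $0$, satisfies $xyz=0$ for all $x,y,z$, and $ab\ne0$ for some $a,b$. $S$ is semirigid if every automorphism of $S$ fixes every element of $S^2=\{ab: a,b\in S\}$. $\left\{ {a \atop b} \right\}$ is the Stirling number of the second kind ($0$ if $b>a$). For an integer partition $\lambda\vdash r$, list its parts with repetition as $\lambda_1,\dots,\lambda_s$, and let $\beta(\lambda)=\sum_{i=1}^{s}\sum_{j=1}^{s}\gcd(\lambda_i,\lambda_j)$ (sum over ordered pairs). If the distinct part sizes of $\lambda$ are $\ell_1,\dots,\ell_q$ with multiplicities $\mu_1,\dots,\mu_q$, put $w(\lambda)=\ell_1^{\mu_1}\cdots\ell_q^{\mu_q}\,\mu_1!\cdots\mu_q!$. *)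

(* Defs.v *)
From HB Require Import structures.
From mathcomp Require Import all_boot all_order all_algebra all_fingroup.
Set Implicit Arguments.
Unset Strict Implicit.
Unset Printing Implicit Defensive.
Import Order.TTheory GRing.Theory Num.Theory.

Section Semigroups.
Variable T : finType.

Definition binop := {ffun T * T -> T}.
Implicit Types (f g : binop) (s : {perm T}).

Definition semigroup f :=
  [forall x, forall y, forall z, f (f (x, y), z) == f (x, f (y, z))].

Definition is_zero f o := [forall x, (f (o, x) == o) && (f (x, o) == o)].

Definition nilpotent3 f :=
  semigroup f &&
  [exists o, [&& is_zero f o,
    [forall x, forall y, forall z, f (f (x, y), z) == o] &
    [exists a, exists b, f (a, b) != o]]].

Definition is_isom s f g :=
  [forall x, forall y, s (f (x, y)) == g (s x, s y)].

Definition isomorphic f g := [exists s, is_isom s f g].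

Definition square f : {set T} := [set f (a, b) | a : T, b : T].

Definition semirigid f :=
  [forall s, is_isom s f f ==> [forall x in square f, s x == x]].

Definition nb_isom_classes (A : {set binop}) : nat :=
  #|equivalence_partition isomorphic A|.

Lemma isomorphic_equiv : equivalence_rel isomorphic.
Proof.
have refl f : isomorphic f f.
  by apply/existsP; exists 1%g; apply/'forall_forallP=> x y; rewrite !perm1.
have sym f g : isomorphic f g -> isomorphic g f.
  case/existsP=> s /'forall_'forall_eqP sfg; apply/existsP; exists s^-1%g.
  by apply/'forall_'forall_eqP=> x y; apply: (@perm_inj _ s); rewrite sfg !permKV.
have trans f g h : isomorphic f g -> isomorphic g h -> isomorphic f h.
  case/existsP=> s /'forall_'forall_eqP sfg.
  case/existsP=> t /'forall_'forall_eqP tgh.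
  apply/existsP; exists (s * t)%g.
  by apply/'forall_'forall_eqP=> x y; rewrite !permM sfg tgh.
move=> f g h; split=> // fg; apply/idP/idP; last exact: trans.
by apply: trans; apply: sym.
Qed.

End Semigroups.

Definition nb_nilpotent3 n :=
  nb_isom_classes [set f : binop 'I_n | nilpotent3 f].

Definition nb_semirigid_nilpotent3 n :=
  nb_isom_classes [set f : binop 'I_n | nilpotent3 f && semirigid f].

Definition stirling2 (a b : nat) : nat :=
  #|[set P : {set {set 'I_a}} | partition P [set: 'I_a] & #|P| == b]|.

Definition is_intpart r (la : seq nat) :=
  [&& sorted geq la, 0 \notin la & sumn la == r].

(* A partition of r has at most r parts, each at most r, so it is represented
   by exactly one element of r.-bseq 'I_r.+1. *)
Definition parts r (la : r.-bseq 'I_r.+1) : seq nat := map val la.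

Definition intparts r : {set r.-bseq 'I_r.+1} :=
  [set la | is_intpart r (parts la)].

Lemma parts_inj r : injective (@parts r).
Proof. by move=> la mu /(inj_map val_inj) /val_inj. Qed.

Lemma intparts_complete r (la : seq nat) :
  is_intpart r la -> exists2 mu, mu \in intparts r & parts mu = la.
Proof.
move=> lar; have [_ la0 /eqP lasum] := and3P lar.
have sz : size (map (@inord r) la) <= r.
  rewrite size_map -lasum; elim: la la0 {lar lasum} => //= x la IHla.
  by rewrite inE negb_or eq_sym -lt0n => /andP[x0 /IHla]; rewrite -add1n; exact: leq_add.
have E : parts (Bseq sz) = la.
  rewrite /parts /= -map_comp map_id_in // => x xla /=.
  by rewrite inordK // ltnS -lasum sumnE (big_rem x) //= leq_addr.
by exists (Bseq sz); rewrite // inE E.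
Qed.

Definition beta (la : seq nat) := \sum_(a <- la) \sum_(b <- la) gcdn a b.

Definition weight (la : seq nat) :=
  \prod_(l <- undup la) (l ^ count_mem l la * (count_mem l la)`!).

Local Open Scope ring_scope.

Definition Q n : rat :=
  \sum_(1 <= r < n.-1) \sum_(la in intparts r)
    (stirling2 (beta (parts la)).+1 (n - r)%N)%:R / (weight (parts la))%:R.

(* Main.v *)
Require Import Defs.
From mathcomp Require Import all_boot all_order all_algebra all_fingroup.
From mathcomp Require Import zify.
(** Burnside's lemma for the symmetric group acting on all multiplication tables
    gives [n! * nb_nilpotent3 n] as the number of pairs [(s, f)] with [s] an
    automorphism of [f], and likewise for semirigid tables. Call a pair rigid if
    [s] moreover fixes every product. A semirigid [f] has only rigid pairs, so
    both inequalities follow once the rigid pairs are counted as [n! * Q n].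

    Let [A] be the set of the [r] elements that are not products. In a rigid pair
    [s] is supported in [A], and [f] is exactly a surjection onto [~: A] from the
    set of [s]-orbits on [A * A] with one extra point added, sent to zero. There
    are [beta] such orbits, hence [stirling2 beta.+1 (n - r) * (n - r)!] choices
    for [f], and [r! / weight la] permutations of [A] have cycle type [la]. *)

Set Implicit Arguments.
Unset Strict Implicit.
Unset Printing Implicit Defensive.
Import Order.TTheory GRing.Theory Num.Theory.

(** * Isomorphism classes as orbits of relabelling *)

Section Burnside.
Variable T : finType.
Implicit Types (f g : binop T) (s : {perm T}) (A : {set binop T}).

(** The table [f] relabelled along [s]. Undoing [s] on the arguments makes this a right action, in
    agreement with the left-to-right product of permutations. *)
Definition transport f s : binop T :=
  [ffun p => s (f ((s^-1)%g p.1, (s^-1)%g p.2))].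

Lemma is_isomE s f g : is_isom s f g = (transport f s == g).
Proof.
apply/'forall_'forall_eqP/eqP=> [sfg | <- x y]; last by rewrite ffunE /= !permK.
by apply/ffunP=> -[x y]; rewrite ffunE sfg !permKV.
Qed.

Lemma transport1 : transport^~ 1%g =1 id.
Proof. by move=> f; apply/ffunP=> -[x y]; rewrite ffunE invg1 !perm1. Qed.

Lemma transportM f s t : transport f (s * t)%g = transport (transport f s) t.
Proof. by apply/ffunP=> -[x y]; rewrite !ffunE /= invMg !permM. Qed.

Definition transport_action := TotalAction transport1 transportM.

(** Closure under isomorphism lets the symmetric group act on [A]. The orbits are the isomorphism
    classes, and the tables fixed by [s] are those having [s] as an automorphism, so the
    Cauchy-Frobenius formula applies. *)
Lemma nb_isom_classes_Burnside A :
  (forall f g, isomorphic f g -> f \in A -> g \in A) ->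
  nb_isom_classes A * #|T|`! = \sum_s #|[set f in A | is_isom s f f]|.
Proof.
move=> isoA; have actsA: [acts [set: {perm T}], on A | transport_action].
  apply/actsP=> s _ f /=; apply/idP/idP; apply: isoA; apply/existsP.
    exists (s^-1)%g; rewrite is_isomE -transportM mulgV; apply/eqP.
    exact: transport1.
  by exists s; rewrite is_isomE.
have /esym := Frobenius_Cauchy actsA.
have -> : #|[set: {perm T}]| = #|T|`!.
  rewrite -[in RHS]cardsT -card_perm; apply: eq_card => s.
  by rewrite inE; apply/esym/subsetP=> x _; rewrite inE.
have -> : orbit transport_action [set: {perm T}] @: A =
          equivalence_partition (@isomorphic T) A.
  apply: eq_in_imset => f fA; apply/setP=> g; rewrite inE.
  apply/orbitP/andP=> [[s _ <-] | [_ /existsP[s]]].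
    have iso_f: isomorphic f (transport f s).
      by apply/existsP; exists s; rewrite is_isomE.
    by split=> //; apply: isoA fA.
  by rewrite is_isomE => /eqP <-; exists s; rewrite ?inE.
move=> ->; apply: eq_big => [s | s _]; first by rewrite inE.
apply: eq_card => f; rewrite !inE is_isomE; congr (_ && _).
by rewrite sub1set inE.
Qed.

End Burnside.

(** * Counting surjections by Stirling numbers *)

Section Surjections.
Variable Y : finType.
Implicit Type B : {set Y}.

(** A map with kernel [P] is an injection from the blocks of [P]. Since there are as many blocks as
    elements of [B], such an injection into [B] is onto, and there are [#|B|] factorial of them. *)
Lemma card_ffun_kernel a (P : {set {set 'I_a}}) B :
    partition P [set: 'I_a] -> #|P| = #|B| ->
  #|[set h : {ffun 'I_a -> Y} | h @: setT == B & preim_partition h setT == P]|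
    = #|B|`!.
Proof.
move=> partP cardP; have [/eqP covP tiP set0P] := and3P partP.
have inP x : pblock P x \in P by rewrite pblock_mem // covP inE.
pose block x : {C | C \in P} := exist _ (pblock P x) (inP x).
have blockE (C : {C | C \in P}) x : x \in val C -> block x = C.
  by case: C => C PC /= xC; apply: val_inj => /=; apply: def_pblock.
have block_surj (C : {C | C \in P}) : exists x, x \in val C.
  apply/set0Pn; apply: contraNneq set0P => C0; rewrite -C0; exact: valP.
pose lift (k : {ffun {C | C \in P} -> Y}) := [ffun x => k (block x)].
have lift_inj : injective lift.
  move=> k k' /ffunP eq_k; apply/ffunP=> C; have [x xC] := block_surj C.
  by have := eq_k x; rewrite !ffunE (blockE C).
rewrite -[RHS]ffactnn -{2}cardP -(card_sig (mem P)) -card_inj_ffuns_on.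
rewrite -(card_imset _ lift_inj); apply: eq_card => h; rewrite inE.
apply/andP/imsetP=> [[/eqP imh /eqP preimh] | [k + ->]]; last first.
  rewrite inE => /andP[/ffun_onP kB /injectiveP injk]; split.
    rewrite eqEcard -cardP -(card_sig (mem P)) -(card_imset _ injk).
    apply/andP; split; first by apply/subsetP=> _ /imsetP[x _ ->]; rewrite ffunE kB.
    apply/subset_leq_card/subsetP=> _ /imsetP[C _ ->].
    have [x xC] := block_surj C; apply/imsetP; exists x => //.
    by rewrite ffunE (blockE C).
  apply/eqP/setP=> C.
  have kE x : [set y in setT | lift k x == lift k y] = pblock P x.
    apply/setP=> y; rewrite !inE /= !ffunE (inj_eq injk) -val_eqE /=.
    by rewrite eq_pblock // covP inE.
  apply/imsetP/idP=> [[x _ ->] | PC]; first by rewrite kE.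
  have [x xC] := block_surj (exist _ C PC); exists x => //.
  by rewrite kE (def_pblock tiP PC xC).
have hE x y : (h x == h y) = (pblock P x == pblock P y).
  rewrite eq_pblock ?covP ?inE // -preimh.
  rewrite /preim_partition pblock_equivalence_partition ?inE //.
  by split=> // /eqP->.
pose k := [ffun C : {C | C \in P} => h (xchoose (block_surj C))].
have kE x : k (block x) = h x.
  rewrite ffunE; apply/eqP; rewrite hE.
  have := xchooseP (block_surj (block x)).
  by move/blockE/(congr1 val) => /= ->.
have bE C : block (xchoose (block_surj C)) = C.
  exact/blockE/xchooseP.
exists k; last by apply/ffunP=> x; rewrite ffunE kE.
rewrite inE; apply/andP; split.
  by apply/ffun_onP=> C; rewrite -imh ffunE imset_f.
apply/injectiveP=> C D; rewrite !ffunE => /eqP; rewrite hE.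
by move=> e; rewrite -(bE C) -(bE D); apply: val_inj; apply/eqP.
Qed.

Lemma card_preim_partition (X : finType) (h : {ffun X -> Y}) :
  #|preim_partition h setT| = #|h @: setT|.
Proof.
rewrite /preim_partition /equivalence_partition.
pose F y := [set z in [set: X] | y == h z].
rewrite -[LHS]/(#|[set F (h x) | x in setT]|) (imset_comp F h).
apply: card_in_imset => _ _ /imsetP[x _ ->] /imsetP[y _ ->] /setP/(_ x).
by rewrite !inE eqxx => /esym/eqP.
Qed.

Lemma card_surjections a B :
  #|[set h : {ffun 'I_a -> Y} | h @: setT == B]| = stirling2 a #|B| * #|B|`!.
Proof.
rewrite -sum1_card.
rewrite (partition_big (fun h : {ffun 'I_a -> Y} => preim_partition h setT)
  (mem [set P | partition P [set: 'I_a] & #|P| == #|B|])) => [|h]; last first.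
  by rewrite !inE => /eqP <-; rewrite preim_partitionP card_preim_partition /=.
rewrite -sum_nat_const; apply: eq_bigr => P; rewrite !inE => /andP[partP /eqP cP].
rewrite -(card_ffun_kernel partP cP) -sum1_card.
by apply: eq_bigl => h; rewrite !inE.
Qed.

(** A map constant on the fibres of [q] is a map on the image of [q]. That image is numbered by
    ordinals because [stirling2] counts partitions of ordinals. *)
Lemma card_factoring_surjections (X Z : finType) (q : X -> Z) B :
  #|[set f : {ffun X -> Y} |
      [forall x, forall y, (q x == q y) ==> (f x == f y)] & f @: setT == B]|
    = stirling2 #|q @: setT| #|B| * #|B|`!.
Proof.
set W := q @: setT.
pose r x : 'I_#|W| := enum_rank_in (imset_f q (in_setT x)) (q x).
have rK x : enum_val (r x) = q x by rewrite enum_rankK_in ?imset_f ?inE.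
have rE x y : (r x == r y) = (q x == q y).
  by rewrite -!rK (inj_eq (@enum_val_inj _ _)).
have r_surj i : exists x, r x == i.
  have /imsetP[x _ qx] := enum_valP i; exists x.
  by apply/eqP/enum_val_inj; rewrite rK.
pose pull (h : {ffun 'I_#|W| -> Y}) := [ffun x => h (r x)].
have pull_im h : pull h @: setT = h @: setT.
  apply/setP=> y; apply/imsetP/imsetP=> [[x _ ->] | [i _ ->]].
    by exists (r x); rewrite ?ffunE.
  by have [x /eqP <-] := r_surj i; exists x; rewrite ?ffunE.
have pull_inj : injective pull.
  move=> h h' /ffunP eq_h; apply/ffunP=> i; have [x /eqP <-] := r_surj i.
  by have := eq_h x; rewrite !ffunE.
rewrite -card_surjections -(card_imset _ pull_inj); apply: eq_card => f.
rewrite inE; apply/andP/imsetP=> [[/forallP qf /eqP imf] | [h + ->]]; last first.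
  rewrite inE => imh; rewrite pull_im; split=> //.
  apply/forallP=> x; apply/forallP=> y; apply/implyP.
  by rewrite -rE => /eqP rxy; rewrite !ffunE rxy.
pose h := [ffun i => f (xchoose (r_surj i))].
have hE : pull h = f.
  apply/ffunP=> x; rewrite !ffunE; apply/eqP.
  apply: (implyP (forallP (qf _) _)); rewrite -rE.
  exact: xchooseP (r_surj (r x)).
by exists h; rewrite // inE -pull_im hE imf.
Qed.

End Surjections.

(** * Orbits of a single permutation *)

Section Porbits.
Variable T : finType.
Implicit Types (s : {perm T}) (A : {set T}).

Lemma iter_perm_id s x k : (iter k s x == x) = (#|porbit s x| %| k).
Proof.
set c := #|_|; have c_gt0 : 0 < c by rewrite lt0n card_porbit_neq0.
rewrite {1}(divn_eq k c) addnC iterD.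
have -> : iter (k %/ c * c) s x = x.
  by elim: (k %/ c) => //= m IHm; rewrite mulSn iterD IHm iter_porbit.
have ltkc := ltn_pmod k c_gt0.
have /= := nth_uniq x (_ : _ < size (traject s x c)) (_ : 0 < _)
  (uniq_traject_porbit s x).
by rewrite size_traject => /(_ (k %% c) ltkc c_gt0); rewrite !nth_traject.
Qed.

Lemma porbit_stable s A x y :
  (forall z, z \in A -> s z \in A) -> x \in A -> y \in porbit s x -> y \in A.
Proof.
move=> sA xA /porbitP[i ->]; rewrite permX.
by elim: i => //= i; apply: sA.
Qed.

Lemma big_porbits (R : Type) (idx : R) (op : Monoid.com_law idx) s A
    (F : nat -> R) :
    (forall z, z \in A -> s z \in A) ->
  \big[op/idx]_(x in A) F #|porbit s x| =
    \big[op/idx]_(C in porbit s @: A) \big[op/idx]_(x in C) F #|C|.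
Proof.
move=> sA; rewrite (partition_big_imset (porbit s)).
apply: eq_bigr => _ /imsetP[x xA ->]; apply: eq_big => [y | y /andP[_ /eqP->] //].
rewrite eq_porbit_mem andb_idl // => y_x.
exact: porbit_stable xA y_x.
Qed.

End Porbits.

(** * Cycle types and orbits on pairs *)

Section CycleType.
Variable T : finType.
Implicit Types (s : {perm T}) (A : {set T}).

(** Fixed points in [A] contribute parts equal to 1. The order of the parts is that of an arbitrary
    enumeration, hence the comparisons by [perm_eq] below. *)
Definition cycle_type s A : seq nat :=
  [seq #|C| | C : {set T} <- enum (porbit s @: A)].

Lemma sum_porbits s A (F : nat -> nat) :
    (forall z, z \in A -> s z \in A) ->
  \sum_(x in A) F #|porbit s x| = \sum_(c <- cycle_type s A) c * F c.
Proof.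
move=> sA; rewrite big_porbits // big_map big_enum /=.
by apply: eq_bigr => C _; rewrite sum_nat_const.
Qed.

Lemma cycle_type_neq0 s A : 0 \notin cycle_type s A.
Proof.
apply/mapP=> -[C]; rewrite mem_enum => /imsetP[x _ ->] /esym/eqP.
by rewrite (negPf (card_porbit_neq0 s x)).
Qed.

Lemma sumn_cycle_type s A :
  (forall z, z \in A -> s z \in A) -> sumn (cycle_type s A) = #|A|.
Proof.
move=> sA; rewrite sumnE -sum1_card (@sum_porbits s A (fun=> 1)) //.
by apply: eq_bigr => c _; rewrite muln1.
Qed.

Lemma perm2_subproof s : injective (fun p : T * T => (s p.1, s p.2)).
Proof. by move=> [x y] [x' y'] /= [/perm_inj-> /perm_inj->]. Qed.

Definition perm2 s : {perm T * T} := perm (@perm2_subproof s).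

(** The [k]-th iterate fixes the pair iff both cycle lengths divide [k]; two numbers with the same
    multiples are equal. *)
Lemma card_porbit_perm2 s x y :
  #|porbit (perm2 s) (x, y)| = lcmn #|porbit s x| #|porbit s y|.
Proof.
have itE k : iter k (perm2 s) (x, y) = (iter k s x, iter k s y).
  by elim: k => //= k ->; rewrite permE.
have dvdE k : (#|porbit (perm2 s) (x, y)| %| k)
               = (lcmn #|porbit s x| #|porbit s y| %| k).
  by rewrite -iter_perm_id itE xpair_eqE !iter_perm_id dvdn_lcm.
by apply/eqP; rewrite eqn_dvd dvdE dvdnn -dvdE dvdnn.
Qed.

(* The number of orbits is the sum of [1 / #|orbit|] over all points, and the
   orbit of [(x, y)] has [lcm] many points. *)
Lemma card_porbits_perm2 s A :
    (forall z, z \in A -> s z \in A) ->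
  #|porbit (perm2 s) @: setX A A| = beta (cycle_type s A).
Proof.
move=> sA; have sAA p : p \in setX A A -> perm2 s p \in setX A A.
  by case: p => x y; rewrite permE !inE => /andP[/sA-> /sA->].
have sumE (F : nat -> rat) : (\sum_(x in A) F #|porbit s x| =
    \sum_(c <- cycle_type s A) c%:R * F c)%R.
  rewrite big_porbits // big_map big_enum /=.
  by apply: eq_bigr => C _; rewrite sumr_const mulr_natl.
apply/eqP; rewrite -(eqr_nat rat); apply/eqP.
transitivity (\sum_(p in setX A A) (#|porbit (perm2 s) p|%:R : rat)^-1)%R.
  rewrite (big_porbits _ (fun c => c%:R^-1)%R) // -sum1_card natr_sum.
  apply: eq_bigr => _ /imsetP[p _ ->]; rewrite sumr_const -[RHS]mulr_natl divff //.
  by rewrite pnatr_eq0 card_porbit_neq0.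
transitivity (\sum_(x in A) \sum_(y in A)
   ((lcmn #|porbit s x| #|porbit s y|)%:R : rat)^-1)%R.
  rewrite pair_big; apply: eq_big => [[x y] | [x y] _]; first by rewrite !inE.
  by rewrite card_porbit_perm2.
under eq_bigr => x _ do rewrite (sumE (fun c => (lcmn _ c)%:R^-1)%R).
rewrite (sumE (fun a => \sum_(c <- _) c%:R * (lcmn a c)%:R^-1)%R).
rewrite /beta natr_sum !big_seq; apply: eq_bigr => a ta.
rewrite natr_sum mulr_sumr !big_seq; apply: eq_bigr => b tb.
have gt0 c : c \in cycle_type s A -> 0 < c.
  by rewrite lt0n; apply: contraTneq => ->; apply: cycle_type_neq0.
(* A pair of cycles of lengths [a] and [b] contributes [a * b / lcmn a b], which is [gcdn a b]. *)
rewrite mulrA -natrM -muln_lcm_gcd natrM mulrAC divff ?mul1r //.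
by rewrite pnatr_eq0 -lt0n lcmn_gt0 !gt0.
Qed.

End CycleType.

(** * Inserting a point into a permutation *)

Section Insertion.
Variable T : finType.
Implicit Types (s : {perm T}) (A : {set T}) (x y : T).

Lemma perm_on_stable s A : perm_on A s -> forall z, z \in A -> s z \in A.
Proof. by move=> sA z zA; rewrite (perm_closed _ sA). Qed.

Lemma perm_eq_enum_setU1 (U : finType) (a : U) (X : {set U}) :
  a \notin X -> perm_eq (enum (a |: X)) (a :: enum X).
Proof.
move=> aX; apply: uniq_perm; rewrite ?cons_uniq ?enum_uniq ?mem_enum ?aX //.
by move=> b; rewrite inE !mem_enum !inE.
Qed.

Lemma cycle_type_insert_fixed s A x :
    x \notin A -> perm_on A s ->
  perm_eq (cycle_type s (x |: A)) (1 :: cycle_type s A).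
Proof.
move=> xA sA; have px : porbit s x = [set x].
  apply/setP=> y; rewrite inE; apply/idP/eqP=> [|->]; last exact: porbit_id.
  move/(porbit_stable (A := [set x])); rewrite !inE => H; apply/eqP/H => // z.
  by rewrite !inE => /eqP->; rewrite (out_perm sA).
rewrite /cycle_type imsetU1 px -[in 1 :: _](cards1 x).
apply: (perm_map (fun C : {set T} => #|C|) (perm_eq_enum_setU1 _)).
apply/imsetP=> -[y yA /setP/(_ y)].
by rewrite porbit_id inE => /eqP eyx; rewrite -eyx yA in xA.
Qed.

(** Products of permutations apply the left factor first, so [tperm x y * s] sends [y] to [x] and
    [x] to [s y]: the point [x] is spliced into the cycle of [y] and the other cycles stay as they
    are. *)
Lemma cycle_type_insert s A x y :
    x \notin A -> perm_on A s -> y \in A ->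
  perm_eq (cycle_type (tperm x y * s)%g (x |: A))
          (#|porbit s y|.+1 :: rem #|porbit s y| (cycle_type s A)).
Proof.
move=> xA sA yA; set t := (tperm x y * s)%g; set C := porbit s y.
have CA z : z \in C -> z \in A := porbit_stable (perm_on_stable sA) yA.
have xC : x \notin C by apply: contra xA => /CA.
have tx : t x = s y by rewrite permM tpermL.
have ty : t y = x by rewrite permM tpermR (out_perm sA).
have tz z : z != x -> z != y -> t z = s z.
  by move=> zx zy; rewrite permM tpermD // eq_sym.
have sC z : (s z \in C) = (z \in C).
  by rewrite -!eq_porbit_mem -(porbit_perm s 1 z) expg1.
have px : porbit t x = x |: C.
  apply/setP=> z; apply/idP/idP=> [zx|].
    apply: porbit_stable zx; rewrite ?setU11 // => w.
    have [->|wx] := eqVneq w x; first by rewrite tx !inE sC porbit_id orbT.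
    have [->|wy] := eqVneq w y; first by rewrite ty setU11.
    by rewrite tz // !inE sC (negPf wx) => /= ->; rewrite orbT.
  rewrite !inE => /predU1P[->|/porbitP[i ->]]; first exact: porbit_id.
  have step w : w \in porbit t x -> t w \in porbit t x.
    by case/porbitP=> k ->; rewrite -permM -expgSr mem_porbit.
  (* The old cycle is followed from [y], which [t] sends to [x]. At each later point [t] agrees with
     [s], except on returning to [y], where the next point [s y] is [t x]. *)
  rewrite permX; elim: i => [|i IHi] /=.
    by rewrite porbit_sym -{1}ty; have := mem_porbit t 1 y; rewrite expg1.
  have iA : iter i s y \in A by rewrite -permX CA // mem_porbit.
  have [->|wy] := eqVneq (iter i s y) y; first by rewrite -tx step ?porbit_id.
  by rewrite -tz ?step //; apply: contraTneq iA => ->.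
have pz z : z \in A -> z \notin C -> porbit t z = porbit s z.
  move=> zA zC; have exp_id n : (t ^+ n)%g z = (s ^+ n)%g z.
    elim: n => // n IHn; rewrite !expgSr !permM IHn tpermD //.
      apply: contraNneq xA => ->.
      exact: porbit_stable (perm_on_stable sA) zA (mem_porbit s n z).
    by apply: contraNneq zC => ey; rewrite porbit_sym ey mem_porbit.
  by apply/setP=> w; apply/porbitP/porbitP=> -[i ->]; exists i; rewrite exp_id.
set X := porbit s @: A; have CX : C \in X by rewrite imset_f.
have imE : porbit t @: (x |: A) = (x |: C) |: X :\ C.
  rewrite imsetU1 px; apply/setP=> D; rewrite in_setU1 [in RHS]in_setU1.
  have [//|neD] /= := eqVneq D (x |: C).
  apply/imsetP/setD1P=> [[z zA eD] | [neC /imsetP[z zA eD]]].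
    have zC : z \notin C.
      apply: contra neD => zC; rewrite eD -px eq_porbit_mem px.
      by rewrite !inE zC orbT.
    rewrite eD (pz z) //; split; last by rewrite imset_f.
    by rewrite eq_porbit_mem.
  exists z => //; rewrite eD pz //.
  by apply: contra neC => zC; rewrite eD eq_porbit_mem.
have xCX : x |: C \notin X :\ C.
  apply/setD1P=> -[_ /imsetP[z zA ezC]]; case/negP: xA.
  apply: (porbit_stable (perm_on_stable sA) zA).
  by rewrite -ezC setU11.
(* Lengths of the untouched cycles: both cycle types are [u] with one more entry, [#|C|] before the
   insertion and [#|C|.+1] after it. *)
pose u := [seq #|D| | D : {set T} <- enum (X :\ C)].
have tE : perm_eq (cycle_type t (x |: A)) (#|C|.+1 :: u).
  rewrite /cycle_type imE -[#|C|.+1]/(1 + #|C|) -[1]/(nat_of_bool true) -xC -cardsU1.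
  exact: (perm_map (fun C : {set T} => #|C|) (perm_eq_enum_setU1 xCX)).
apply: perm_trans tE _; rewrite perm_cons perm_sym.
have sE : perm_eq (cycle_type s A) (#|C| :: u).
  rewrite /cycle_type -/X -(setD1K CX).
  by apply: (perm_map (fun C : {set T} => #|C|) (perm_eq_enum_setU1 _)); rewrite setD11.
have cs : #|C| \in cycle_type s A by rewrite (perm_mem sE) mem_head.
by rewrite -(perm_cons #|C|) -(permPl (perm_to_rem cs)).
Qed.

Lemma perm_on_setU1_insert s A x y :
    x \notin A -> y \in x |: A ->
  perm_on (x |: A) (tperm x y * s)%g && (((tperm x y * s)^-1)%g x == y)
    = perm_on A s.
Proof.
move=> xA yA; apply/andP/idP=> [[tsA /eqP tsx] | sA]; last first.
  split; last first.
    by rewrite (canF_eq (permKV _)) permM tpermR (out_perm sA).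
  apply: perm_onM; apply/subsetP=> z zt.
    have /subsetP/(_ z zt) := tperm_on x y.
    by rewrite in_set2 => /pred2P[]->; rewrite ?setU11.
  by rewrite in_setU1 (subsetP sA z zt) orbT.
have sx : s x = x by have := permKV (tperm x y * s)%g x; rewrite tsx permM tpermR.
apply/subsetP=> z; rewrite inE => sz.
have zx : z != x by apply: contraNneq sz => ->; rewrite sx.
have [ezy | zy] := eqVneq z y.
  by move: yA; rewrite -ezy in_setU1 (negPf zx).
have tz : tperm x y z = z by rewrite tpermD // eq_sym.
by have /subsetP/(_ z) := tsA; rewrite !inE permM tz sz (negPf zx); apply.
Qed.

(** Permutations of [x |: A] are sorted by the preimage [y] of [x]; the case [y = x] covers those
    fixing [x]. *)
Lemma sum_perm_on_setU1 A x (F : {perm T} -> nat) :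
    x \notin A ->
  \sum_(s | perm_on (x |: A) s) F s =
    \sum_(y in x |: A) \sum_(s | perm_on A s) F (tperm x y * s)%g.
Proof.
move=> xA; rewrite (partition_big (fun s : {perm T} => (s^-1)%g x) (mem (x |: A))).
  apply: eq_bigr => y yA; rewrite (reindex_inj (mulgI (tperm x y))) /=.
  by apply: eq_bigl => s; rewrite perm_on_setU1_insert.
by move=> s sA /=; rewrite (perm_closed _ (perm_onV sA)) setU11.
Qed.

End Insertion.

(** * The weight of a partition under a change of parts *)

Section Weight.
Implicit Types (la mu tau : seq nat).

Lemma perm_weight la mu : perm_eq la mu -> weight la = weight mu.
Proof.
move=> lamu; rewrite /weight.
rewrite (perm_big _ (perm_undup (perm_mem lamu))) /=.
by apply: eq_bigr => l _; rewrite (seq.permP lamu).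
Qed.

(** Raising the multiplicity of [l] from [m] to [m.+1] turns [l ^ m * m!] into
    [l ^ m.+1 * m.+1!]. *)
Lemma weight_cons l mu :
  weight (l :: mu) = weight mu * (l * (count_mem l mu).+1).
Proof.
rewrite /weight /=; case: ifP => [lmu | /negbT lmu]; last first.
  rewrite big_cons /= eqxx (count_memPn lmu) addn0 expn1 mulnC.
  congr (_ * _); apply: eq_big_seq => k; rewrite mem_undup => kmu.
  by have /negPf-> : l != k by apply: contraNneq lmu => ->.
rewrite -mem_undup in lmu.
rewrite !(bigD1_seq l) ?undup_uniq //= eqxx add1n expnS factS.
rewrite [RHS]mulnAC; congr (_ * _); last first.
  by apply: eq_bigr => k kl; rewrite eq_sym (negPf kl).
by rewrite mulnACA mulnC.
Qed.

Lemma sum_count_mem la m (F : nat -> nat) : (forall a, a \in la -> a < m) ->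
  \sum_(a <- la) F a = \sum_(c < m) count_mem (c : nat) la * F c.
Proof.
elim: la => [|a la IHla] ltm; first by rewrite big_nil big1.
rewrite big_cons IHla => [|b bla]; last by rewrite ltm // inE bla orbT.
under [RHS]eq_bigr => c _ do rewrite /= mulnDl.
rewrite big_split /=; congr (_ + _); have am := ltm a (mem_head _ _).
rewrite (bigD1 (Ordinal am)) //= eqxx mul1n big1 ?addn0 // => c.
by rewrite -val_eqE eq_sym /= => /negPf->.
Qed.

(** Raising a part [c] of [tau] to [c.+1] gives [la] exactly when lowering a part [c.+1] of [la] to
    [c] gives [tau]. This trades a condition on the unknown [tau] for one that fixes it up to order.
    If [c] is not in [tau], then [rem] does nothing, but the count vanishes. *)
Lemma count_mem_perm_rem la tau c :
  count_mem c tau * perm_eq la (c.+1 :: rem c tau) =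
    (c.+1 \in la) * ((count_mem c (rem c.+1 la)).+1
                     * perm_eq (c :: rem c.+1 la) tau).
Proof.
have [cla | cla] := boolP (c.+1 \in la); last first.
  case: (boolP (perm_eq _ _)) => [/perm_mem/(_ c.+1)|]; last by rewrite muln0.
  by rewrite mem_head (negPf cla).
rewrite (permPl (perm_to_rem cla)) perm_cons mul1n.
have [ctau | ctau] := boolP (c \in tau); last first.
  rewrite (count_memPn ctau).
  case: (boolP (perm_eq (_ :: _) _)) => [/perm_mem/(_ c)|]; last by rewrite muln0.
  by rewrite mem_head (negPf ctau).
rewrite (permPr (perm_to_rem ctau)) perm_cons.
case: (boolP (perm_eq _ _)) => [remE|]; last by rewrite !muln0.
by rewrite (seq.permP (perm_to_rem ctau)) /= eqxx (seq.permP remE).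
Qed.

End Weight.

(** * The number of permutations of a given cycle type *)

Section CycleTypeCount.
Variable T : finType.
Implicit Types (A : {set T}) (la : seq nat).

(* Each permutation of [x |: A'] arises once by inserting [x] into a permutation
   of [A'], either as a fixed point or right after some [y]; the latter turns a
   cycle of length [c] into one of length [c.+1], in [c] ways. *)
Lemma cycle_type_count A la :
    0 \notin la -> sumn la = #|A| ->
  (\sum_(s | perm_on A s) perm_eq la (cycle_type s A)) * weight la = #|A|`!.
Proof.
move: {2}#|A| (erefl #|A|) => r; elim: r A la => [|r IHr] A la cardA la0 sumla.
  have -> : la = [::].
    case: la la0 sumla => //= a la; rewrite inE negb_or cardA.
    by case: a.
  rewrite cardA /weight big_nil muln1; move/eqP: cardA; rewrite cards_eq0 => /eqP->.
  rewrite (big_pred1 1%g) => [|s]; last first.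
    apply/idP/eqP=> [s0 | ->]; last exact: perm_on1.
    by apply/permP=> x; rewrite perm1 (out_perm s0) ?inE.
  by rewrite /cycle_type imset0 enum_set0.
have /set0Pn[x xA] : A != set0 by rewrite -card_gt0 cardA.
pose A' := A :\ x; have xA' : x \notin A' by rewrite setD11.
have defA : x |: A' = A by rewrite setD1K.
have cardA' : #|A'| = r by move: cardA; rewrite (cardsD1 x) xA => -[].
pose N mu := \sum_(s | perm_on A' s) perm_eq mu (cycle_type s A').
(* The cycle type left after deleting a point from a cycle of length [c.+1]; a cycle of length 1
   disappears instead of leaving a part 0. *)
pose lower c := if c is 0 then rem 1 la else c :: rem c.+1 la.
have IHN c : c.+1 \in la -> N (lower c) * weight (lower c) = r`!.
  move=> cla; have rem0 : 0 \notin rem c.+1 la by apply: contra la0; apply: mem_rem.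
  have sumrem : c + sumn (rem c.+1 la) = r.
    by move: sumla; rewrite !sumnE (big_rem _ cla) cardA /= addSn => -[].
  rewrite -cardA'; apply: IHr => //; rewrite /lower; first by case: c {cla sumrem} rem0.
  by rewrite cardA' -sumrem; case: (c).
have NE : \sum_(s | perm_on A s) perm_eq la (cycle_type s A) =
    (1 \in la) * N (rem 1 la) +
    \sum_(c < r.+1) c * ((c.+1 \in la) * ((count_mem (c : nat) (rem c.+1 la)).+1
        * N ((c : nat) :: rem c.+1 la))).
  rewrite -[in LHS]defA sum_perm_on_setU1 // big_setU1 //=; congr (_ + _).
    rewrite big_distrr; apply: eq_bigr => s sA' /=.
    rewrite tperm1 mul1g (permPr (cycle_type_insert_fixed xA' sA')).
    have [la1 | la1] := boolP (1 \in la).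
      by rewrite (permPl (perm_to_rem la1)) perm_cons mul1n.
    by case: (boolP (perm_eq _ _)) => // /perm_mem/(_ 1); rewrite mem_head (negPf la1).
  rewrite exchange_big /=.
  under [RHS]eq_bigr => c _ do rewrite /N !big_distrr /=.
  rewrite [RHS]exchange_big /=; apply: eq_bigr => s sA'.
  under eq_bigr => y yA' do rewrite (permPr (cycle_type_insert xA' sA' yA')).
  have stA' := perm_on_stable sA'.
  rewrite (sum_porbits
    (fun c => nat_of_bool (perm_eq la (c.+1 :: rem c (cycle_type s A'))))) //.
  rewrite (sum_count_mem (m := r.+1)) => [|c]; last first.
    move=> cs; rewrite ltnS -cardA' -(sumn_cycle_type stA') sumnE (big_rem c) //=.
    exact: leq_addr.
  by apply: eq_bigr => c _; rewrite mulnCA count_mem_perm_rem.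
have wE c : c.+1 \in la ->
    weight la = weight (rem c.+1 la) * (c.+1 * count_mem c.+1 la).
  move=> cla; rewrite (perm_weight (perm_to_rem cla)) weight_cons.
  by rewrite [in RHS](seq.permP (perm_to_rem cla)) /= eqxx.
have -> : (\sum_(s | perm_on A s) perm_eq la (cycle_type s A)) * weight la =
    \sum_(c < r.+1) c.+1 * count_mem c.+1 la * r`!.
  rewrite NE mulnDl big_distrl /= !big_ord_recl /= mul0n add0n; congr (_ + _).
    have [la1 | /count_memPn->] := boolP (1 \in la); last by rewrite !mul0n.
    by rewrite !mul1n (wE 0) // mulnA (IHN 0) // mulnC mul1n.
  apply: eq_bigr => c _; rewrite /bump /= add1n.
  have [cla | /count_memPn->] := boolP (c.+2 \in la); last by rewrite muln0 !mul0n muln0.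
  (* The number of ways to insert is the very factor by which the new part [c.+1] multiplies the
     weight, so only the factor of [weight la] due to [c.+2] survives. *)
  rewrite (wE c.+1) // -(IHN c.+1) //= weight_cons.
  rewrite mul1n; move: (N _) (weight _) (count_mem _ _) (count_mem _ _) => a b d e.
  by rewrite -!mulnA; nia.
(* Apart from [r!], what remains is the sum of part size times multiplicity, that is [sumn la],
   which equals [r.+1]. *)
rewrite -big_distrl /= cardA factS; congr (_ * _).
transitivity (sumn la); last by rewrite sumla.
rewrite sumnE (sum_count_mem (m := r.+2)) => [|c cla].
  by rewrite [RHS]big_ord_recl muln0 add0n; apply: eq_bigr => c _; rewrite mulnC.
by rewrite ltnS -cardA -sumla sumnE (big_rem c) //= leq_addr.
Qed.

End CycleTypeCount.

(** * Sums over permutations as sums over partitions *)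

Section IntegerPartitions.
Local Open Scope ring_scope.

Lemma weight_gt0 la : 0%N \notin la -> (0 < weight la)%N.
Proof.
move=> la0; rewrite /weight big_seq_cond prodn_cond_gt0 // => l.
rewrite andbT mem_undup => lla; rewrite muln_gt0 fact_gt0 expn_gt0 andbT lt0n.
by apply/orP; left; apply: contraNneq la0 => <-.
Qed.

(** Sorting its cycle type matches each permutation with exactly one partition, and
    [cycle_type_count] gives the size of each class. *)
Lemma sum_cycle_type (T : finType) (A : {set T}) (H : seq nat -> nat) :
    (forall la mu, perm_eq la mu -> H la = H mu) ->
  (\sum_(s | perm_on A s) H (cycle_type s A))%:R =
    (#|A|`!)%:R *
      \sum_(la in intparts #|A|) (H (parts la))%:R / (weight (parts la))%:R :> rat.
Proof.
move=> permH; set r := #|A|.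
have HE (s : {perm T}) : perm_on A s -> H (cycle_type s A) =
    (\sum_(la in intparts r) perm_eq (parts la) (cycle_type s A) * H (parts la))%N.
  move=> sA; have stA := perm_on_stable sA.
  have psort : perm_eq (sort geq (cycle_type s A)) (cycle_type s A).
    by rewrite perm_sort.
  have geq_tr : transitive geq by move=> a b c ab /leq_trans; apply.
  have [|mu mur muE] := @intparts_complete r (sort geq (cycle_type s A)).
    rewrite /is_intpart sort_sorted; last by move=> a b; apply: leq_total.
    rewrite mem_sort cycle_type_neq0 /= !sumnE (perm_big _ psort) -sumnE.
    by rewrite sumn_cycle_type.
  rewrite (bigD1 mu) //= muE psort mul1n (permH _ _ psort) big1 ?addn0 //.
  move=> la /andP[]; rewrite inE => /and3P[la_sorted _ _] la_mu.
  case: (boolP (perm_eq _ _)) => // la_s; case/eqP: la_mu.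
  apply: parts_inj; rewrite muE; apply: (sorted_eq geq_tr) => //.
  - by move=> a b; rewrite andbC; apply: anti_leq.
  - by apply: sort_sorted => a b; apply: leq_total.
  - by rewrite (permPr psort).
rewrite (eq_bigr _ HE) exchange_big natr_sum mulr_sumr /=.
apply: eq_bigr => la; rewrite inE => /and3P[_ la0 /eqP sumla].
rewrite -big_distrl /= natrM -(cycle_type_count la0 sumla) natrM.
rewrite [RHS]mulrACA mulfV ?mulr1 // pnatr_eq0 -lt0n.
exact: weight_gt0.
Qed.

End IntegerPartitions.

(** * The structure and number of rigid pairs *)

Section RigidAutomorphisms.
Variable T : finType.
Implicit Types (f : binop T) (s : {perm T}) (A : {set T}).

Lemma square_imset f : square f = f @: setT.
Proof.
apply/setP=> z; apply/imset2P/imsetP=> [[x y _ _ ->] | [[x y] _ ->]].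
  by exists (x, y).
by exists x y.
Qed.

Definition rigid_aut s f :=
  [&& nilpotent3 f, is_isom s f f & [forall x in square f, s x == x]].

(* [set0] is the common class of all the pairs whose product must vanish. *)
Definition product_class s A (p : T * T) : {set T * T} :=
  if p \in setX A A then porbit (perm2 s) p else set0.

(** The extra 1 is the class [set0]: it differs from every orbit, orbits being nonempty, and it is
    attained at [(z, z)] for any [z] outside [A]. *)
Lemma card_product_class s A : perm_on A s -> A != setT ->
  #|product_class s A @: setT| = (beta (cycle_type s A)).+1.
Proof.
move=> sA neT; have stA := perm_on_stable sA.
have [z zA] : exists z, z \notin A.
  have /set0Pn[z] : ~: A != set0 by rewrite -setCT (inj_eq (@setC_inj _)).
  by rewrite inE; exists z.
have -> : product_class s A @: setT = set0 |: porbit (perm2 s) @: setX A A.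
  apply/setP=> C; rewrite in_setU1; apply/imsetP/predU1P=> [[p _ ->] | [-> | ]].
  - rewrite /product_class; case: ifP => [pA|]; last by left.
    by right; rewrite imset_f.
  - by exists (z, z); rewrite // /product_class inE /= (negPf zA).
  - by case/imsetP=> p pA ->; exists p; rewrite // /product_class pA.
rewrite cardsU1 card_porbits_perm2 //; case: imsetP => // -[p _ /esym p0].
by have := porbit_id (perm2 s) p; rewrite p0 inE.
Qed.

(** Triple products vanish iff every pair outside [A * A] has product zero. The bounds on [#|A|] say
    that there is a non-product and that there are at least two products, so one is nonzero. *)
Lemma rigid_autE s f (A := ~: (f @: setT)) :
  rigid_aut s f =
    [&& perm_on A s, 0 < #|A| < #|T|.-1 &
        [forall p, forall p',
          (product_class s A p == product_class s A p') ==> (f p == f p')]].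
Proof.
have imf x y : f (x, y) \notin A by rewrite inE negbK imset_f.
have cardA : #|A| + #|f @: setT| = #|T| by rewrite addnC cardsC.
have permE2 p : perm2 s p = (s p.1, s p.2) by rewrite permE.
apply/and3P/and3P=> [[nilf autf fixf] | [sA rA /forallP facf]].
  have {nilf} /andP[/'forall_'forall_forallP assf] := nilf.
  case/existsP=> o /and3P[/forallP of0 /'forall_'forall_forallP nilf].
  case/'exists_existsP=> a [b fab].
  have oA : o \notin A.
    by have /andP[_ /eqP <-] := of0 o; apply: imf.
  have f0l x y : x \notin A -> f (x, y) = o.
    rewrite inE negbK => /imsetP[[u v] _ ->]; exact/eqP/nilf.
  have f0r x y : y \notin A -> f (x, y) = o.
    rewrite inE negbK => /imsetP[[u v] _ ->]; rewrite -(eqP (assf _ _ _)).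
    exact/eqP/nilf.
  have f0 p : p \notin setX A A -> f p = o.
    by case: p => x y; rewrite inE negb_and /= => /orP[/f0l|/f0r].
  have sA : perm_on A s.
    apply/subsetP=> x; rewrite inE; apply: contraR; rewrite inE negbK.
    rewrite -square_imset; exact: (implyP (forallP fixf x)).
  have aA : a \in A by apply: contraR fab => /f0l->.
  split=> //.
    apply/andP; split; first by rewrite card_gt0; apply/set0Pn; exists a.
    have : 1 < #|f @: setT|.
      apply/card_gt1P; exists (f (a, b)), o; rewrite ?imset_f //.
      by rewrite inE negbK in oA.
    by move: cardA; lia.
  apply/forallP=> p; apply/forallP=> p'; apply/implyP.
  rewrite /product_class; case: ifPn => [pA | /f0 ->].
    case: ifPn => [p'A | _ /eqP p0]; last first.
      by have := porbit_id (perm2 s) p; rewrite p0 inE.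
    rewrite eq_porbit_mem => /porbitP[i ->]; rewrite permX.
    (* Here [f (s x, s y) = s (f (x, y)) = f (x, y)], as [s] fixes products; hence [f] is constant
       along the orbit. *)
    elim: i => //= i /eqP<-; apply/eqP; rewrite permE2.
    case: (iter i _ _) => x y /=; rewrite -(eqP ('forall_forallP autf _ _)).
    by rewrite (out_perm sA).
  case: ifPn => [p'A /eqP/esym p0 | /f0 -> //].
  by have := porbit_id (perm2 s) p'; rewrite p0 inE.
have stA := perm_on_stable sA.
have cardB : 1 < #|f @: setT| by move: cardA rA; lia.
(* Since [b] is a product, [(b, b)] lies in the class [set0], and the common value of [f] on that
   class serves as zero. *)
have [b bB] : exists b, b \in f @: setT by apply/card_gt0P; apply: ltnW.
pose o := f (b, b).
have f0 p : p \notin setX A A -> f p = o.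
  move=> pA; apply/eqP/(implyP (forallP (facf _) _)).
  by rewrite /product_class (negPf pA) !inE bB.
have f0l x y : x \notin A -> f (x, y) = o.
  by move=> xA; apply: f0; rewrite inE negb_and xA.
have f0r x y : y \notin A -> f (x, y) = o.
  by move=> yA; apply: f0; rewrite inE negb_and yA orbT.
have oA : o \notin A by apply: imf.
split.
- apply/andP; split.
    by apply/'forall_'forall_'forall_eqP=> x y z; rewrite f0l // f0r.
  apply/existsP; exists o; apply/and3P; split.
  + by apply/forallP=> x; rewrite f0l // f0r // eqxx.
  + by apply/'forall_'forall_'forall_eqP=> x y z; rewrite f0l.
  + case/card_gt1P: cardB => _ [_ [/imsetP[[x y] _ ->] /imsetP[[x' y'] _ ->] ne]].
    have [exy | nexy] := eqVneq (f (x, y)) o.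
      by apply/'exists_existsP; exists x', y'; rewrite -exy eq_sym.
    by apply/'exists_existsP; exists x, y.
- apply/'forall_'forall_eqP=> x y; rewrite (out_perm sA) //; apply/eqP.
  apply: (implyP (forallP (facf _) _)); rewrite /product_class !in_setX /=.
  rewrite !(perm_closed _ sA); case: ifP => // _.
  rewrite eq_porbit_mem porbit_sym -[(s x, s y)](permE2 (x, y)).
  by have := mem_porbit (perm2 s) 1 (x, y); rewrite expg1.
- apply/forallP=> x; apply/implyP; rewrite square_imset => xB.
  by rewrite (out_perm sA) // inE negbK.
Qed.

Lemma card_rigid_aut s :
  #|[set f | rigid_aut s f]| =
    \sum_(A : {set T} | (0 < #|A| < #|T|.-1) && perm_on A s)
      stirling2 (beta (cycle_type s A)).+1 (#|T| - #|A|) * (#|T| - #|A|)`!.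
Proof.
rewrite -sum1_card (partition_big (fun f : binop T => ~: (f @: setT))
  (fun A => (0 < #|A| < #|T|.-1) && perm_on A s)) => [|f]; last first.
  by rewrite inE rigid_autE => /and3P[-> ->].
apply: eq_bigr => A /andP[rA sA].
have -> : #|T| - #|A| = #|~: A| by rewrite -(cardsC A) addKn.
rewrite -card_product_class //; last first.
  by apply: contraTneq rA => ->; rewrite cardsT; lia.
rewrite -card_factoring_surjections -sum1_card; apply: eq_bigl => f.
rewrite !inE rigid_autE -[X in _ = _ && X](inj_eq (@setC_inj _)) setCK.
case: eqP => [-> | _]; last by rewrite !andbF.
by rewrite !andbT rA sA.
Qed.

End RigidAutomorphisms.

(** * Summing the rigid pairs *)

Section SumOverPermutations.
Local Open Scope ring_scope.

Lemma sum_rigid_aut n :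
  (\sum_(s : {perm 'I_n}) #|[set f : binop 'I_n | rigid_aut s f]|)%:R
    = (n`!)%:R * Q n.
Proof.
under eq_bigr => s _ do rewrite card_rigid_aut card_ord.
rewrite (exchange_big_dep (fun A : {set 'I_n} => 0 < #|A| < n.-1)%N) /=; last first.
  by move=> s A _ /andP[].
pose K r : rat := \sum_(la in intparts r)
  (stirling2 (beta (parts la)).+1 (n - r)%N)%:R / (weight (parts la))%:R.
have KE (A : {set 'I_n}) : (0 < #|A| < n.-1)%N ->
    (\sum_(s | (0 < #|A| < n.-1) && perm_on A s)
       stirling2 (beta (cycle_type s A)).+1 (n - #|A|) * (n - #|A|)`!)%N%:R
    = (#|A|`! * (n - #|A|)`!)%:R * K #|A|.
  move=> ->; rewrite -big_distrl /= natrM.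
  rewrite (sum_cycle_type _ (H := fun la => stirling2 (beta la).+1 _)).
    by rewrite natrM mulrAC.
  move=> la mu lamu; congr (stirling2 _.+1 _); rewrite /beta.
  rewrite (perm_big _ lamu) /=; apply: eq_bigr => a _; exact: perm_big.
rewrite natr_sum (eq_bigr _ KE).
have -> : Q n = \sum_(1 <= r < n.-1) K r by [].
(* The summand depends on [A] only through its size; a dummy index [r] for that size allows the two
   sums to be swapped. *)
transitivity (\sum_(A : {set 'I_n}) \sum_(1 <= r < n.-1 | r == #|A|)
                (r`! * (n - r)`!)%:R * K r).
  by rewrite big_mkcond; apply: eq_bigr => A _; rewrite big_nat1_eq.
rewrite (exchange_big_dep xpredT) //= mulr_sumr.
apply: eq_big_nat => r /andP[r1 rn].
have le_rn : (r <= n)%N by lia.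
rewrite (eq_bigl (fun A => A \in [set A : {set 'I_n} | #|A| == r])) => [|A].
  (* The number of sets [A] of size [r] is a binomial coefficient, which absorbs [r! * (n - r)!]
     into [n!]. *)
  rewrite sumr_const card_draws card_ord -[LHS]mulr_natl mulrA -natrM.
  by rewrite bin_fact.
by rewrite inE eq_sym.
Qed.

End SumOverPermutations.

(** * Invariance under isomorphism and the two inequalities *)

Lemma isomorphic_nilpotent3 (T : finType) (f g : binop T) :
  isomorphic f g -> nilpotent3 f -> nilpotent3 g.
Proof.
case/existsP=> s; rewrite is_isomE => /eqP <- /andP[/'forall_'forall_'forall_eqP assf].
case/existsP=> o /and3P[/forallP of0 /'forall_'forall_'forall_eqP nilf].
case/'exists_existsP=> a [b fab]; apply/andP; split.
  by apply/'forall_'forall_'forall_eqP=> x y z; rewrite !ffunE /= !permK assf.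
apply/existsP; exists (s o); apply/and3P; split.
- apply/forallP=> x; rewrite !ffunE /= !permK !(inj_eq perm_inj).
  exact: of0.
- by apply/'forall_'forall_'forall_eqP=> x y z; rewrite !ffunE /= !permK nilf.
- apply/'exists_existsP; exists (s a), (s b).
  by rewrite ffunE /= !permK (inj_eq perm_inj).
Qed.

Lemma isomorphic_semirigid (T : finType) (f g : binop T) :
  isomorphic f g -> semirigid f -> semirigid g.
Proof.
case/existsP=> s /'forall_'forall_eqP sfg /forallP semf.
apply/forallP=> t; apply/implyP=> /'forall_'forall_eqP tg.
apply/forallP=> x; apply/implyP=> /imset2P[a b _ _ ->{x}].
(* Conjugation by the isomorphism [s] carries the automorphism [t] of [g] back to one of [f]. *)
pose u := (s * t * s^-1)%g.
have uf : is_isom u f f.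
  apply/'forall_'forall_eqP=> x y; rewrite /u !permM sfg tg.
  by apply: (@perm_inj _ s); rewrite permKV sfg !permKV.
have /forallP/(_ (f ((s^-1)%g a, (s^-1)%g b))) := implyP (semf u) uf.
rewrite square_imset imset_f //= /u !permM sfg !permKV => /eqP/(congr1 s).
by rewrite permKV sfg !permKV => ->.
Qed.

Unset Implicit Arguments.
Local Open Scope ring_scope.

Theorem theorem6p5 (n : nat) (hn : (3 <= n)%N) :
  (nb_semirigid_nilpotent3 n)%:R <= Q n /\ Q n <= (nb_nilpotent3 n)%:R.
Proof.
have fact_gt : (0 : rat) < (n`!)%:R by rewrite ltr0n fact_gt0.
have closedN (f g : binop 'I_n) : isomorphic f g ->
    f \in [set f : binop 'I_n | nilpotent3 f] ->
    g \in [set f : binop 'I_n | nilpotent3 f].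
  by rewrite !inE; apply: isomorphic_nilpotent3.
have closedS (f g : binop 'I_n) : isomorphic f g ->
    f \in [set f : binop 'I_n | nilpotent3 f && semirigid f] ->
    g \in [set f : binop 'I_n | nilpotent3 f && semirigid f].
  rewrite !inE => fg /andP[nilf semf].
  by rewrite (isomorphic_nilpotent3 fg) ?(isomorphic_semirigid fg).
(* After multiplication by [n!], both inequalities compare sums over permutations and hold term by
   term: semirigidity makes each pair rigid, and a rigid pair is in particular an automorphism of a
   nilpotent table. *)
split; rewrite -(ler_pM2l fact_gt) -sum_rigid_aut -natrM mulnC ler_nat.
  have := nb_isom_classes_Burnside closedS; rewrite card_ord => ->.
  apply: leq_sum => s _; apply/subset_leq_card/subsetP=> f.
  rewrite !inE => /andP[/andP[nilf /forallP semf] sf].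
  by rewrite /rigid_aut nilf sf (implyP (semf s)).
have := nb_isom_classes_Burnside closedN; rewrite card_ord => ->.
apply: leq_sum => s _; apply/subset_leq_card/subsetP=> f.
by rewrite !inE => /and3P[-> ->].
Qed.
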